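(* Let $a\in(0,1)$, $c\in(0,a)$, and let $P(z) = (z-a)\prod_{j=1}^{n-1}(z-z_j)$ be a polynomial of degree $n$ that contradicts Sendov's conjecture at $a$. Define $\mathcal{N}_0(a) = \frac{32 \log ( 40/a^2 )}{a^2}$, $$\mathcal{N}_1(a) = \max \left \{ 9 \left( \frac{4+2a}{a} \right)^2 , \mathcal{N}_0(a) \right \},\qquad \mathcal{N}_2(a,c) = \max \left \{ 9 \left( \frac{\log ( a/16 )}{\log \left( \frac{c}{1+a} \right) } \right)^2 , \mathcal{N}_0(a) \right \}.$$ If $n \geq \max \{\mathcal{N}_1(a), \mathcal{N}_2(a,c)\}$, then $|P(c)| \leq 1 + a$.
   Context: A polynomial $P(z) = (z-a)\prod_{j=1}^{n-1}(z-z_j)$ with $a\in(0,1)$ and $|z_j|\le 1$ for all $j$ is said to contradict Sendov's conjecture at $a$ if every zero $w$ of $P'$ satisfies $|w-a|>1$. *)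

(* Defs.v *)
From Stdlib Require Import Reals List.
Open Scope R_scope.

Definition Cx : Type := (R * R)%type.
Definition RtoC (x : R) : Cx := (x, 0).
Definition C0 : Cx := (0, 0).
Definition Cadd (z w : Cx) : Cx := (fst z + fst w, snd z + snd w).
Definition Copp (z : Cx) : Cx := (- fst z, - snd z).
Definition Csub (z w : Cx) : Cx := Cadd z (Copp w).
Definition Cmul (z w : Cx) : Cx :=
  (fst z * fst w - snd z * snd w, fst z * snd w + snd z * fst w).
Definition Cnorm (z : Cx) : R := sqrt (fst z * fst z + snd z * snd z).

(* Polynomials over Cx as coefficient lists, lowest degree first:
   [c0; c1; ...; cd] represents c0 + c1 X + ... + cd X^d. *)
Definition cpoly := list Cx.

Fixpoint peval (p : cpoly) (z : Cx) : Cx :=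
  match p with
  | nil => C0
  | c :: p' => Cadd c (Cmul z (peval p' z))
  end.

Fixpoint padd (p q : cpoly) : cpoly :=
  match p, q with
  | nil, _ => q
  | _, nil => p
  | a :: p', b :: q' => Cadd a b :: padd p' q'
  end.

Definition pscale (c : Cx) (p : cpoly) : cpoly := map (Cmul c) p.

Definition pmul_Xsub (r : Cx) (p : cpoly) : cpoly :=
  padd (C0 :: p) (pscale (Copp r) p).

Fixpoint prod_Xsub (rs : list Cx) : cpoly :=
  match rs with
  | nil => RtoC 1 :: nil
  | r :: rs' => pmul_Xsub r (prod_Xsub rs')
  end.

Fixpoint pderiv_aux (k : nat) (p : cpoly) : cpoly :=
  match p with
  | nil => nil
  | c :: p' => Cmul (RtoC (INR k)) c :: pderiv_aux (S k) p'
  end.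
Definition pderiv (p : cpoly) : cpoly :=
  match p with
  | nil => nil
  | _ :: p' => pderiv_aux 1 p'
  end.

Definition sendov_poly (a : R) (zs : list Cx) : cpoly := prod_Xsub (RtoC a :: zs).

Definition contradicts_sendov (a : R) (zs : list Cx) : Prop :=
  forall w : Cx, peval (pderiv (sendov_poly a zs)) w = C0 -> Cnorm (Csub w (RtoC a)) > 1.

Definition N0 (a : R) : R := 32 * ln (40 / a ^ 2) / a ^ 2.
Definition N1 (a : R) : R := Rmax (9 * ((4 + 2 * a) / a) ^ 2) (N0 a).
Definition N2 (a c : R) : R :=
  Rmax (9 * (ln (a / 16) / ln (c / (1 + a))) ^ 2) (N0 a).

(* Main.v *)
(** Let [w_1 .. w_m], [m = n - 1], be the critical points of [P] and
    [Q z = prod (z - w_i)], so that [P' = n Q].  By Gauss-Lucas and the hypothesis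
    the [w_i] lie in the lune [|w| <= 1 <= |a - w|].  Put [M = |Q a|] and
    [L = sum 1 / (a - w_i)].

    - By Stewart's theorem on [|s - w|], [|Q s| <= M exp (- m s (a - s) / 2)].
    - [P'' / P'] is close to [L] near [a], hence [L P] to [P' - P' a]; evaluation
      at [a / 2], where [P'] is negligible, gives [|P (a/2)| >= 7 M / 9].
    - Integrating [P'] from [0], where [|P| <= a], bounds [|P (a/2)|] by
      [a + O(sqrt M / a)].  Comparison gives [M <= (6 / a)^2], so the excess
      [sum (|a - w_i|^2 - 1)] is at most [3 m a^2 / 16].
    - The defect [sum (1 - |w_i|^2)] is at least [m a^2 / 4]: otherwise the [w_i],
      hence also the roots of [P], have a large mean real part, and [P (a/2)] is
      exponentially small.
    - So [P'] is negligible on [[0, a/2]], and [|P| <= a + 1/1000] there.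
    - For [c] in [[a/2, a]], integrating [P'] from [a] gives
      [|P c| <~ (4 / a) |P (a/2)| (1 - v)] with [v = exp (- m a (a - c) / 4)], while
      [L P ~ P' - P' a] gives [|P c| <~ |P (a/2)| (1 + v)]; eliminating [v] yields
      [|P c| <~ 8 a / (4 + a)], which leaves enough room below [1 + a]. *)
From Stdlib Require Import Reals List Lra Lia.
From Coquelicot Require Import Coquelicot.
From mathcomp Require all_boot all_order all_algebra Rstruct.
From mathcomp.real_closed Require complex.
Require Import Defs.
Open Scope R_scope.

Fixpoint sum_over {T : Type} (f : T -> R) (s : list T) : R :=
  match s with
  | nil => 0
  | x :: s' => f x + sum_over f s'
  end.

Fixpoint root_prod (rs : list C) (z : C) : C :=
  match rs with
  | nil => 1
  | r :: rs' => (z - r) * root_prod rs' z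
  end%C.

Fixpoint log_deriv (rs : list C) (z : C) : C :=
  match rs with
  | nil => 0
  | r :: rs' => / (z - r) + log_deriv rs' z
  end%C.

(** * Complex derivatives *)

Lemma Re_le_Cmod (z : C) : Re z <= Cmod z.
Proof. eapply Rle_trans; [apply Rle_abs | apply re_le_Cmod]. Qed.

Lemma Cminus_0_r (z : C) : (z - 0)%C = z.
Proof. ring. Qed.

Lemma Cmod_minus_sym (y z : C) : Cmod (y - z) = Cmod (z - y).
Proof. rewrite <- Cmod_opp; f_equal; ring. Qed.

Lemma Cmod_minus_triangle (x y z : C) : Cmod (x - z) <= Cmod (x - y) + Cmod (y - z).
Proof. replace (x - z)%C with (x - y + (y - z))%C by ring; apply Cmod_triangle. Qed.

Lemma Cmod_triangle3 (x y z : C) : Cmod (x + y + z) <= Cmod x + Cmod y + Cmod z.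
Proof. pose proof (Cmod_triangle (x + y) z); pose proof (Cmod_triangle x y); lra. Qed.

Lemma Cmod_INR_mult (k : nat) (z : C) : Cmod (INR k * z) = INR k * Cmod z.
Proof. rewrite Cmod_mult, Cmod_R, Rabs_pos_eq; auto using pos_INR. Qed.

Lemma Cmod_RtoC_minus_pow2 (s : R) (w : C) : Cmod (s - w) ^ 2 = s ^ 2 - 2 * s * Re w + Cmod w ^ 2.
Proof. rewrite !Cmod2_alt; unfold Re, Im; simpl; ring. Qed.

Lemma exists_unit_rotation (z : C) : exists u : C, Cmod u = 1 /\ (u * z)%C = Cmod z.
Proof.
  destruct (Req_dec (Cmod z) 0) as [Hz|Hz].
  - exists 1%C; rewrite Hz, (Cmod_eq_0 z Hz); split; [apply Cmod_1 | apply Cmult_0_r].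
  - assert (Hz' : (Cmod z : C) <> 0%C) by (intros E; now apply Hz, RtoC_inj).
    pose proof (Cmod_ge_0 z); exists (Cconj z / Cmod z)%C; split.
    + rewrite Cmod_div, Cmod_conj, Cmod_R, Rabs_pos_eq by auto; now field.
    + replace (Cconj z / Cmod z * z)%C with (z * Cconj z / Cmod z)%C by now field.
      rewrite <- Cmod2_conj, RtoC_pow; now field.
Qed.

Lemma Re_Cinv_pos (z : C) : 0 < Re z -> 0 < Re (/ z).
Proof.
  intros Hz; unfold Re, Cinv in *; simpl.
  apply Rdiv_lt_0_compat; [auto|]; nra.
Qed.

(* Coquelicot equips [C] with two normed module structures over itself, which
   have the same derivatives. *)
Lemma is_derive_C_AbsRing (f : C -> C) (z l : C) :
  is_derive (V := C_NormedModule) f z l <->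
  is_derive (V := AbsRing_NormedModule C_AbsRing) f z l.
Proof. split; intros [_ H]; (split; [apply is_linear_scal_l | exact H]). Qed.

Lemma is_derive_Cmult (f g : C -> C) (z df dg : C) :
  is_derive f z df -> is_derive g z dg ->
  is_derive (fun x => f x * g x)%C z (df * g z + f z * dg)%C.
Proof.
  rewrite !is_derive_C_AbsRing; intros Hf Hg.
  exact (is_derive_mult (K := C_AbsRing) f g z df dg Hf Hg Cmult_comm).
Qed.

Lemma is_derive_Cmult_const (c : C) (f : C -> C) (z df : C) :
  is_derive f z df -> is_derive (fun x => c * f x)%C z (c * df)%C.
Proof.
  intros Hf; evar_last.
  - apply is_derive_Cmult; [apply is_derive_const | exact Hf].
  - unfold zero; simpl; ring.
Qed.

Lemma is_derive_Cid (z : C) : is_derive (fun x : C => x) z (1 : C).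
Proof. apply is_derive_C_AbsRing, (is_derive_id (K := C_AbsRing)). Qed.

Lemma is_derive_Cminus_const (c z : C) : is_derive (fun x => x - c)%C z (1 : C).
Proof.
  evar_last.
  - apply (is_derive_minus (V := C_NormedModule) (fun x => x) (fun _ => c)).
    + apply is_derive_Cid.
    + apply is_derive_const.
  - unfold minus, zero, opp, plus; simpl; ring.
Qed.

Lemma is_derive_Re (f : C -> C) (x : R) (l : C) :
  is_derive f (x : C) l -> is_derive (fun t : R => Re (f t)) x (Re l).
Proof.
  intros [_ H]; split; [apply is_linear_scal_l|].
  intros y Hy; rewrite <- (is_filter_lim_locally_unique _ _ Hy); clear y Hy; intros eps.
  destruct (H (x : C) (fun P HP => HP) eps) as [d Hd]; exists d; intros t Ht.
  assert (Ht' : ball (M := AbsRing_UniformSpace C_AbsRing) (x : C) d (t : C)).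
  { change (Cmod (t - x) < d); rewrite <- RtoC_minus, Cmod_R; exact Ht. }
  specialize (Hd (t : C) Ht').
  change (Cmod (f t - f x - (t - x) * l) <= eps * Cmod (t - x)) in Hd.
  rewrite <- !RtoC_minus, Cmod_R in Hd.
  eapply Rle_trans; [|exact Hd].
  eapply Rle_trans; [|apply re_le_Cmod].
  right; change (Rabs (Re (f t) - Re (f x) - (t - x) * Re l) =
    Rabs (Re (f t - f x - (t - x)%R * l))); f_equal.
  unfold Cminus; rewrite !re_plus, !re_opp, re_scal_l; ring.
Qed.

Lemma nondecreasing_of_derive_ge_0 (f df : R -> R) (u v : R) :
  u <= v ->
  (forall s, u <= s <= v -> is_derive f s (df s)) ->
  (forall s, u <= s <= v -> 0 <= df s) ->
  f u <= f v.
Proof.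
  intros Huv Hf Hdf.
  destruct (MVT_gen f u v df) as [s [Hs E]];
    rewrite Rmin_left, Rmax_right in * by lra.
  - intros; apply Hf; lra.
  - intros s Hs; apply derivable_continuous_pt; exists (df s); now apply is_derive_Reals, Hf.
  - pose proof (Hdf s Hs); nra.
Qed.

(* Rotating the increment onto the positive axis reduces the mean value
   inequality to the real case. *)
Lemma Cmod_increment_le (f df : C -> C) (phi dphi : R -> R) (u v : R) :
  u <= v ->
  (forall s, u <= s <= v -> is_derive f (s : C) (df s)) ->
  (forall s, u <= s <= v -> is_derive phi s (dphi s)) ->
  (forall s, u <= s <= v -> Cmod (df s) <= dphi s) ->
  Cmod (f v - f u) <= phi v - phi u.
Proof.
  intros Huv Hf Hphi Hle.
  destruct (exists_unit_rotation (f v - f u)) as [e [He Ee]].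
  assert (Hmono : phi u - Re (e * f u) <= phi v - Re (e * f v)).
  { apply (nondecreasing_of_derive_ge_0 (fun s => phi s - Re (e * f s))
      (fun s => dphi s - Re (e * df s))); auto.
    - intros s Hs; apply (is_derive_minus (V := R_NormedModule)); [now apply Hphi|].
      apply (is_derive_Re (fun z => e * f z)%C), is_derive_Cmult_const, Hf, Hs.
    - intros s Hs; pose proof (Re_le_Cmod (e * df s)) as H.
      rewrite Cmod_mult, He in H; specialize (Hle s Hs); lra. }
  apply (f_equal Re) in Ee.
  replace (e * (f v - f u))%C with (e * f v - e * f u)%C in Ee by ring.
  unfold Cminus in Ee; rewrite re_plus, re_opp, re_RtoC in Ee; unfold Cminus; lra.
Qed.

(** * Polynomials given by their roots *)

Module CriticalPoints.
Import all_boot all_order all_algebra complex Rstruct.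
Import GRing.Theory Num.Theory.
Local Open Scope ring_scope.
Local Notation Re := Coquelicot.Complex.Re.

Lemma deriv_prod_XsubC (F : numClosedFieldType) (rs : seq F) :
  rs != [::] ->
  exists ws, [/\ size rs = (size ws).+1,
    (\prod_(r <- rs) ('X - r%:P))^`() = (size rs)%:R *: \prod_(w <- ws) ('X - w%:P) &
    (size ws)%:R * \sum_(r <- rs) r = (size rs)%:R * \sum_(w <- ws) w].
Proof.
rewrite -size_eq0; set p := \prod_(r <- rs) _; case size_rs: (size rs) => [//|m] _.
have size_p : size p = m.+2 by rewrite size_prod_XsubC size_rs.
have lead_p : p`_m.+1 = 1.
  by have := monic_prod_XsubC rs xpredT id; rewrite monicE lead_coefE -/p size_p => /eqP.
have degree_neq0 : m.+1%:R != 0 :> F by rewrite pnatr_eq0.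
have lead_dp : p^`()`_m = m.+1%:R by rewrite coef_deriv lead_p.
have size_dp : size p^`() = m.+1.
  apply/eqP; rewrite eqn_leq -{1}ltnS -{1}size_p lt_size_deriv -?size_poly_eq0 ?size_p //=.
  by rewrite ltnNge; apply: contra degree_neq0 => /leq_sizeP/(_ m (leqnn m)); rewrite lead_dp => ->.
have [ws] := closed_field_poly_normal p^`().
rewrite lead_coefE size_dp lead_dp => def_dp.
have size_ws : size ws = m by move: size_dp; rewrite def_dp size_scale // size_prod_XsubC => -[].
exists ws; split; rewrite ?size_ws //.
have [m0|m_gt0] := posnP m.
  by rewrite (size0nil (etrans size_ws m0)) m0 mul0r big_nil mulr0.
have : p^`()`_m.-1 = p`_m *+ m by rewrite coef_deriv prednK.
have -> : p`_m = - \sum_(r <- rs) r by rewrite -coefPn_prod_XsubC size_rs.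
rewrite def_dp coefZ; have := coefPn_prod_XsubC (ps := ws); rewrite size_ws -lt0n => -> //.
by rewrite mulrN mulNrn => /oppr_inj; rewrite mulr_natl => ->.
Qed.

Definition ofC (z : C) : R[i] := Complex z.1 z.2.
Definition toC (z : R[i]) : C := (complex.Re z, complex.Im z).
Lemma ofCK : cancel ofC toC. Proof. by case. Qed.
Lemma toCK : cancel toC ofC. Proof. by case. Qed.
Lemma ofCD z w : ofC (Cadd z w) = ofC z + ofC w. Proof. by []. Qed.
Lemma ofCM z w : ofC (Cmul z w) = ofC z * ofC w. Proof. by []. Qed.
Lemma ofCN z : ofC (Copp z) = - ofC z. Proof. by []. Qed.
Lemma ofC_nat n : ofC (RtoC (INR n)) = n%:R.
Proof.
elim: n => [//|n IH]; rewrite S_INR mulrSr -IH.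
by apply/eqP; rewrite eq_complex /= addr0 !eqxx.
Qed.

Definition poly_of (p : cpoly) : {poly R[i]} := Poly (map ofC p).

Lemma poly_of_cons c p : poly_of (c :: p) = poly_of p * 'X + (ofC c)%:P.
Proof. by rewrite /poly_of /= cons_poly_def. Qed.

Lemma horner_poly_of p z : (poly_of p).[ofC z] = ofC (peval p z).
Proof.
elim: p => [|c p IH]; first by rewrite /poly_of /= horner0.
by rewrite poly_of_cons hornerMXaddC IH addrC mulrC.
Qed.

Lemma poly_of_add p q : poly_of (padd p q) = poly_of p + poly_of q.
Proof.
elim: p q => [|a p IH] [|b q] /=; rewrite ?[poly_of [::]]/poly_of ?add0r ?addr0 //=.
by rewrite !poly_of_cons IH ofCD polyCD mulrDl addrACA.
Qed.

Lemma poly_of_scale c p : poly_of (pscale c p) = (ofC c)%:P * poly_of p.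
Proof.
elim: p => [|b p IH]; first by rewrite /poly_of /= mulr0.
by rewrite /= !poly_of_cons IH ofCM polyCM mulrDr mulrA.
Qed.

Lemma poly_of_prod_Xsub rs :
  poly_of (prod_Xsub rs) = \prod_(z <- map ofC rs) ('X - z%:P).
Proof.
elim: rs => [|r rs IH] /=.
  by rewrite big_nil /poly_of /= cons_poly_def mul0r add0r.
rewrite big_cons -IH poly_of_add poly_of_scale poly_of_cons ofCN polyCN.
by rewrite addr0 mulrBl mulNr ['X * _]mulrC.
Qed.

Lemma poly_of_deriv_aux k p :
  poly_of (pderiv_aux k p) = (poly_of p)^`() * 'X + k%:R%:P * poly_of p.
Proof.
elim: p k => [|c p IH] k /=; first by rewrite /poly_of /= deriv0 mulr0 mul0r addr0.
rewrite !poly_of_cons IH ofCM ofC_nat derivMXaddC.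
rewrite polyCM mulrDr -natr1 polyCD !mulrDl mul1r !mulrA.
by rewrite !addrA; congr (_ + _); rewrite addrC !addrA.
Qed.

Lemma poly_of_deriv p : poly_of (pderiv p) = (poly_of p)^`().
Proof.
case: p => [|c p] /=; first by rewrite /poly_of /= deriv0.
by rewrite poly_of_deriv_aux poly_of_cons derivMXaddC mul1r addrC.
Qed.

Lemma ofC_root_prod rs z :
  ofC (root_prod rs z) = (\prod_(r <- map ofC rs) ('X - r%:P)).[ofC z].
Proof.
elim: rs => [|r rs IH] /=; first by rewrite big_nil hornerC.
by rewrite big_cons hornerM -IH hornerXsubC.
Qed.

Lemma peval_prod_Xsub rs z : peval (prod_Xsub rs) z = root_prod rs z.
Proof.
by apply: (can_inj ofCK); rewrite -horner_poly_of poly_of_prod_Xsub ofC_root_prod.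
Qed.

Lemma Re_sum_ofC zs : complex.Re (\sum_(z <- map ofC zs) z) = sum_over Re zs.
Proof.
elim: zs => [|z zs IH] /=; first by rewrite big_nil.
by rewrite big_cons raddfD /= IH.
Qed.

Lemma pderiv_prod_Xsub (rs : list C) :
  rs <> nil ->
  exists ws : list C,
    length rs = S (length ws) /\
    (forall z, peval (pderiv (prod_Xsub rs)) z =
       Cmult (RtoC (INR (length rs))) (root_prod ws z)) /\
    (INR (length ws) * sum_over Re rs = INR (length rs) * sum_over Re ws)%R.
Proof.
move=> rs_neq0; have /deriv_prod_XsubC[ws []] : map ofC rs != [::] by case: (rs) rs_neq0.
have <- : map ofC (map toC ws) = ws by rewrite mapK //; exact: toCK.
move: (map toC ws) => {}ws; rewrite !size_map => size_rs dP sums.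
exists ws; split; [exact: size_rs | split].
- move=> z; apply: (can_inj ofCK).
  by rewrite -horner_poly_of poly_of_deriv poly_of_prod_Xsub dP hornerZ -ofC_root_prod -ofC_nat.
- have /(congr1 (@complex.Re R)) := sums.
  by rewrite !mulr_natl !raddfMn /= !Re_sum_ofC !INRE !mulr_natl.
Qed.

End CriticalPoints.

Lemma peval_cons (c : C) (p : cpoly) (z : C) : peval (c :: p) z = (c + z * peval p z)%C :> C.
Proof. reflexivity. Qed.

Lemma peval_pderiv_aux_S (k : nat) (p : cpoly) (z : C) :
  peval (pderiv_aux (S k) p) z = (peval (pderiv_aux k p) z + peval p z)%C :> C.
Proof.
  revert k; induction p as [|c p IH]; intros k; [symmetry; apply Cplus_0_l|].
  cbn [pderiv_aux]; rewrite !peval_cons, IH, S_INR.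
  change (Cmul (Defs.RtoC (INR k + 1)) c) with ((INR k + 1)%R * c)%C.
  change (Cmul (Defs.RtoC (INR k)) c) with (INR k * c)%C.
  rewrite RtoC_plus; ring.
Qed.

Lemma peval_pderiv_cons (c : C) (p : cpoly) (z : C) :
  peval (pderiv (c :: p)) z = (peval p z + z * peval (pderiv p) z)%C :> C.
Proof.
  destruct p as [|b p]; cbn [pderiv pderiv_aux].
  - change (@eq C 0 (0 + z * 0)%C); ring.
  - rewrite !peval_cons, (peval_pderiv_aux_S 1).
    change (Cmul (Defs.RtoC (INR 1)) b) with (1 * b)%C; ring.
Qed.

Lemma is_derive_peval (p : cpoly) (z : C) :
  is_derive (peval p : C -> C) z (peval (pderiv p) z : C).
Proof.
  induction p as [|c p IH]; [apply (is_derive_const (V := C_NormedModule))|].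
  rewrite peval_pderiv_cons; evar_last.
  - apply (is_derive_plus (V := C_NormedModule) (fun _ => c) (fun x => x * peval p x)%C).
    + apply is_derive_const.
    + apply is_derive_Cmult; [apply is_derive_Cid | exact IH].
  - unfold plus, zero; simpl; ring.
Qed.

Lemma is_derive_root_prod (rs : list C) (z : C) :
  (forall r, In r rs -> z <> r) ->
  is_derive (root_prod rs) z (root_prod rs z * log_deriv rs z)%C.
Proof.
  induction rs as [|r rs IH]; intros Hz; cbn [log_deriv].
  - rewrite Cmult_0_r; apply (is_derive_const (V := C_NormedModule)).
  - evar_last.
    + apply (is_derive_Cmult (fun x => x - r)%C (root_prod rs)).
      * apply is_derive_Cminus_const.
      * apply IH; intros; apply Hz; now right.
    + cbn [root_prod]; field; apply Cminus_eq_contra, Hz; now left.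
Qed.

Lemma root_prod_neq_0 (rs : list C) (z : C) :
  (forall r, In r rs -> z <> r) -> root_prod rs z <> 0%C.
Proof.
  induction rs as [|r rs IH]; intros Hz; [apply C1_nz|].
  apply Cmult_neq_0; [apply Cminus_eq_contra, Hz; now left|].
  apply IH; intros; apply Hz; now right.
Qed.

Lemma root_prod_root (rs : list C) (r : C) : In r rs -> root_prod rs r = 0%C.
Proof.
  induction rs as [|r' rs IH]; intros Hr; [destruct Hr|]; cbn [root_prod].
  destruct Hr as [->|Hr]; [|rewrite (IH Hr)]; ring.
Qed.

Lemma Re_log_deriv_pos (rs : list C) (u z : C) :
  u <> 0%C -> rs <> nil -> (forall r, In r rs -> 0 < Re (u * (z - r))) ->
  0 < Re (/ u * log_deriv rs z).
Proof.
  intros Hu Hne Hr.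
  assert (Hterm : forall r, In r rs -> 0 < Re (/ u * / (z - r))).
  { intros r Hin; replace (/ u * / (z - r))%C with (/ (u * (z - r)))%C.
    - now apply Re_Cinv_pos, Hr.
    - field; split; auto; intros E; specialize (Hr r Hin).
      rewrite E, Cmult_0_r in Hr; simpl in Hr; lra. }
  clear Hr; induction rs as [|r rs IH]; [congruence|]; cbn [log_deriv].
  rewrite Cmult_plus_distr_l, re_plus.
  apply Rplus_lt_le_0_compat; [apply Hterm; now left|].
  destruct rs as [|r' rs].
  - simpl; lra.
  - left; apply IH; [discriminate|]; intros; apply Hterm; now right.
Qed.

Theorem Gauss_Lucas_half_plane (rs : list C) (u w : C) (h : R) :
  u <> 0%C -> rs <> nil -> (forall r, In r rs -> Re (u * r) <= h) ->
  is_derive (root_prod rs) w (0 : C) -> Re (u * w) <= h.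
Proof.
  intros Hu Hne Hr Hw; apply Rnot_lt_le; intros Hlt.
  assert (Hpos : forall r, In r rs -> 0 < Re (u * (w - r))).
  { intros r Hin; specialize (Hr r Hin).
    replace (u * (w - r))%C with (u * w + - (u * r))%C by ring.
    rewrite re_plus, re_opp; lra. }
  assert (Hneq : forall r, In r rs -> w <> r).
  { intros r Hin ->; specialize (Hpos r Hin).
    replace (u * (r - r))%C with (0 : C) in Hpos by ring; simpl in Hpos; lra. }
  pose proof (Re_log_deriv_pos rs u w Hu Hne Hpos) as Hre.
  pose proof (is_C_derive_unique _ _ _ (is_derive_root_prod rs w Hneq)) as E.
  rewrite (is_C_derive_unique _ _ _ Hw) in E.
  destruct (Ceq_dec (log_deriv rs w) 0) as [H0|H0].
  - rewrite H0, Cmult_0_r in Hre; simpl in Hre; lra.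
  - now apply (Cmult_neq_0 _ _ (root_prod_neq_0 rs w Hneq) H0).
Qed.

Theorem Gauss_Lucas_disk (rs : list C) (w z0 : C) (rho : R) :
  rs <> nil -> (forall r, In r rs -> Cmod (r - z0) <= rho) ->
  is_derive (root_prod rs) w (0 : C) -> Cmod (w - z0) <= rho.
Proof.
  intros Hne Hr Hw.
  destruct (exists_unit_rotation (w - z0)) as [u [Hu Eu]].
  assert (Hu0 : u <> 0%C) by (apply Cmod_gt_0; lra).
  assert (H : Re (u * w) <= rho + Re (u * z0)).
  { apply (Gauss_Lucas_half_plane rs u w); auto; intros r Hin.
    replace (u * r)%C with (u * (r - z0) + u * z0)%C by ring; rewrite re_plus.
    pose proof (Re_le_Cmod (u * (r - z0))) as H; rewrite Cmod_mult, Hu in H.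
    specialize (Hr r Hin); lra. }
  apply (f_equal Re) in Eu; rewrite re_RtoC in Eu.
  replace (u * (w - z0))%C with (u * w + - (u * z0))%C in Eu by ring.
  rewrite re_plus, re_opp in Eu; lra.
Qed.

(** * Bounds on the exponential *)

Lemma exp_le_compat (x y : R) : x <= y -> exp x <= exp y.
Proof. intros [H| ->]; [left; now apply exp_increasing | apply Rle_refl]. Qed.

Lemma exp_INR_mult (n : nat) (x : R) : exp (INR n * x) = exp x ^ n.
Proof.
  induction n as [|n IH].
  - simpl; rewrite Rmult_0_l; apply exp_0.
  - rewrite S_INR, Rmult_plus_distr_r, Rmult_1_l, exp_plus, IH; simpl; ring.
Qed.

Lemma exp_mul_exp_opp (x : R) : exp x * exp (- x) = 1.
Proof. rewrite <- exp_plus, Rplus_opp_r; apply exp_0. Qed.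

Lemma mul_exp_opp_le_1 (x : R) : x * exp (- x) <= 1.
Proof.
  pose proof (exp_ineq1_le x); pose proof (exp_pos (- x)); pose proof (exp_mul_exp_opp x).
  nra.
Qed.

Lemma exp_half_ln (x : R) : 0 < x -> exp (ln x / 2) = sqrt x.
Proof. intros Hx; rewrite <- Rpower_sqrt by auto; unfold Rpower; f_equal; field. Qed.

Lemma exp_half_pow2 (x : R) : exp (x / 2) ^ 2 = exp x.
Proof. rewrite <- (exp_INR_mult 2); f_equal; simpl; field. Qed.

Lemma le_exp_half (x y : R) : x ^ 2 <= exp y -> x <= exp (y / 2).
Proof.
  intros H; apply Rsqr_incr_0_var; [|left; apply exp_pos].
  now rewrite !Rsqr_pow2, exp_half_pow2.
Qed.

Lemma exp_le_affine (u : R) : 0 <= u <= 1 -> exp u <= 1 + 3 * u.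
Proof.
  intros Hu.
  enough (1 + 3 * 0 - exp 0 <= 1 + 3 * u - exp u) by (rewrite exp_0 in *; lra).
  apply (nondecreasing_of_derive_ge_0 (fun s => 1 + 3 * s - exp s) (fun s => 3 - exp s)); [lra| |].
  - intros s _; auto_derive; [auto | ring].
  - intros s Hs; pose proof (exp_le_compat s 1 ltac:(lra)); pose proof exp_le_3; lra.
Qed.

Lemma pow2_sub_1_le_ln (x : R) : 1 <= x <= 2 -> x ^ 2 - 1 <= 6 * ln x.
Proof.
  intros Hx.
  assert (H : ln (exp ((x ^ 2 - 1) / 3)) <= ln (x ^ 2)).
  { apply ln_le; [apply exp_pos|].
    pose proof (exp_le_affine ((x ^ 2 - 1) / 3) ltac:(nra)); lra. }
  rewrite ln_exp, ln_pow in H by lra; simpl in H; lra.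
Qed.

(** * Sums and products over a list of points *)

Lemma sum_over_ge_0 {T : Type} (f : T -> R) (s : list T) :
  (forall x, In x s -> 0 <= f x) -> 0 <= sum_over f s.
Proof.
  induction s as [|x s IH]; intros H; simpl; [lra|].
  pose proof (H x (or_introl eq_refl)).
  pose proof (IH (fun y Hy => H y (or_intror Hy))); lra.
Qed.

Lemma sum_over_plus {T : Type} (f g : T -> R) (s : list T) :
  sum_over (fun x => f x + g x) s = sum_over f s + sum_over g s.
Proof. induction s as [|x s IH]; simpl; [|rewrite IH]; ring. Qed.

Lemma sum_over_scal {T : Type} (b : R) (f : T -> R) (s : list T) :
  sum_over (fun x => b * f x) s = b * sum_over f s.
Proof. induction s as [|x s IH]; simpl; [|rewrite IH]; ring. Qed.

Lemma sum_over_const {T : Type} (b : R) (s : list T) :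
  sum_over (fun _ => b) s = INR (length s) * b.
Proof.
  induction s as [|x s IH]; cbn [sum_over length]; [simpl; ring|].
  rewrite IH, S_INR; ring.
Qed.

Lemma sum_over_ext {T : Type} (f g : T -> R) (s : list T) :
  (forall x, f x = g x) -> sum_over f s = sum_over g s.
Proof. intros H; induction s as [|x s IH]; simpl; [|rewrite H, IH]; reflexivity. Qed.

Lemma root_prod_pow2_le_exp (f : C -> R) (ws : list C) (z : C) :
  (forall w, In w ws -> Cmod (z - w) ^ 2 <= exp (f w)) ->
  Cmod (root_prod ws z) ^ 2 <= exp (sum_over f ws).
Proof.
  induction ws as [|w ws IH]; intros H; cbn [root_prod sum_over].
  - rewrite Cmod_1, exp_0; lra.
  - rewrite Cmod_mult, Rpow_mult_distr, exp_plus.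
    apply Rmult_le_compat; auto using pow2_ge_0.
    + apply H; now left.
    + apply IH; intros; apply H; now right.
Qed.

Lemma root_prod_le_root_prod (ws : list C) (y z : C) (e : R) :
  (forall w, In w ws -> Cmod (z - w) <= Cmod (y - w) * e) ->
  Cmod (root_prod ws z) <= Cmod (root_prod ws y) * e ^ length ws.
Proof.
  induction ws as [|w ws IH]; intros H; cbn [root_prod length pow]; [lra|].
  rewrite !Cmod_mult.
  replace (Cmod (y - w) * Cmod (root_prod ws y) * (e * e ^ length ws)) with
    (Cmod (y - w) * e * (Cmod (root_prod ws y) * e ^ length ws)) by ring.
  apply Rmult_le_compat; auto using Cmod_ge_0.
  - apply H; now left.
  - apply IH; intros; apply H; now right.
Qed.

Lemma root_prod_ge_1 (ws : list C) (z : C) :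
  (forall w, In w ws -> 1 <= Cmod (z - w)) -> 1 <= Cmod (root_prod ws z).
Proof.
  induction ws as [|w ws IH]; intros H; cbn [root_prod].
  - rewrite Cmod_1; lra.
  - rewrite Cmod_mult; pose proof (H w (or_introl eq_refl)).
    pose proof (IH (fun v Hv => H v (or_intror Hv))); nra.
Qed.

Lemma root_prod_le_1 (ws : list C) (z : C) :
  (forall w, In w ws -> Cmod (z - w) <= 1) -> Cmod (root_prod ws z) <= 1.
Proof.
  induction ws as [|w ws IH]; intros H; cbn [root_prod].
  - rewrite Cmod_1; lra.
  - rewrite Cmod_mult; pose proof (H w (or_introl eq_refl)).
    pose proof (IH (fun v Hv => H v (or_intror Hv))).
    pose proof (Cmod_ge_0 (z - w)); pose proof (Cmod_ge_0 (root_prod ws z)); nra.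
Qed.

Lemma sum_pow2_sub_1_le_ln (ws : list C) (z : C) :
  (forall w, In w ws -> 1 <= Cmod (z - w) <= 2) ->
  sum_over (fun w => Cmod (z - w) ^ 2 - 1) ws <= 6 * ln (Cmod (root_prod ws z)).
Proof.
  induction ws as [|w ws IH]; intros H; cbn [root_prod sum_over].
  - rewrite Cmod_1, ln_1; lra.
  - pose proof (pow2_sub_1_le_ln _ (H w (or_introl eq_refl))).
    pose proof (IH (fun v Hv => H v (or_intror Hv))).
    assert (1 <= Cmod (root_prod ws z)) by (apply root_prod_ge_1; intros; apply H; now right).
    destruct (H w (or_introl eq_refl)).
    rewrite Cmod_mult, ln_mult by lra; lra.
Qed.

Lemma neq_of_Cmod_minus_pos (z w : C) : 0 < Cmod (z - w) -> z <> w.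
Proof.
  intros H ->; replace (w - w)%C with (0 : C) in H by ring; rewrite Cmod_0 in H; lra.
Qed.

Lemma Cmod_Cinv_minus_le (z w : C) (delta : R) :
  0 < delta -> delta <= Cmod (z - w) -> Cmod (/ (z - w)) <= / delta.
Proof.
  intros Hd Hz; rewrite Cmod_inv.
  - now apply Rinv_le_contravar.
  - apply Cminus_eq_contra, neq_of_Cmod_minus_pos; lra.
Qed.

Lemma log_deriv_le (ws : list C) (z : C) (delta : R) :
  0 < delta -> (forall w, In w ws -> delta <= Cmod (z - w)) ->
  Cmod (log_deriv ws z) <= INR (length ws) * / delta.
Proof.
  intros Hd; induction ws as [|w ws IH]; intros H; cbn [log_deriv length].
  - rewrite Cmod_0; simpl; lra.
  - eapply Rle_trans; [apply Cmod_triangle|]; rewrite S_INR.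
    pose proof (Cmod_Cinv_minus_le z w delta Hd (H w (or_introl eq_refl))).
    pose proof (IH (fun v Hv => H v (or_intror Hv))); lra.
Qed.

Lemma log_deriv_minus_le (ws : list C) (y z : C) (delta eps : R) :
  0 < delta -> 0 < eps ->
  (forall w, In w ws -> delta <= Cmod (y - w) /\ eps <= Cmod (z - w)) ->
  Cmod (log_deriv ws y - log_deriv ws z) <=
  INR (length ws) * (Cmod (z - y) * (/ delta * / eps)).
Proof.
  intros Hd He; induction ws as [|w ws IH]; intros H; cbn [log_deriv length].
  - replace (0 - 0)%C with (0 : C) by ring; rewrite Cmod_0; simpl; lra.
  - destruct (H w (or_introl eq_refl)) as [Hy Hz].
    replace (/ (y - w) + log_deriv ws y - (/ (z - w) + log_deriv ws z))%C with
      ((z - y) * (/ (y - w) * / (z - w)) + (log_deriv ws y - log_deriv ws z))%C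
      by (field; split; apply Cminus_eq_contra, neq_of_Cmod_minus_pos; lra).
    eapply Rle_trans; [apply Cmod_triangle|].
    rewrite S_INR, Rmult_plus_distr_r, Rmult_1_l, Rplus_comm, !Cmod_mult.
    apply Rplus_le_compat; [apply IH; intros; apply H; now right|].
    apply Rmult_le_compat_l; [apply Cmod_ge_0|].
    apply Rmult_le_compat; auto using Cmod_ge_0, Cmod_Cinv_minus_le.
Qed.

(** * Points of the lune *)

Definition in_lune (a : R) (w : C) : Prop := Cmod w <= 1 <= Cmod (a - w).

Definition outer_excess (a : R) (w : C) : R := Cmod (a - w) ^ 2 - 1.

Definition inner_defect (w : C) : R := 1 - Cmod w ^ 2.

Lemma outer_excess_ge_0 (a : R) (w : C) : in_lune a w -> 0 <= outer_excess a w.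
Proof. intros [_ H]; unfold outer_excess; nra. Qed.

Lemma inner_defect_ge_0 (a : R) (w : C) : in_lune a w -> 0 <= inner_defect w.
Proof. intros [H _]; unfold inner_defect; pose proof (Cmod_ge_0 w); nra. Qed.

(* Stewart's theorem on the distances from [w] to [0], [s] and [a] *)
Lemma Cmod_minus_pow2_interp (a s : R) (w : C) :
  a <> 0 ->
  Cmod (s - w) ^ 2 =
  1 + (s / a * outer_excess a w + - (1 - s / a) * inner_defect w + - (s * (a - s))).
Proof.
  intros Ha; unfold outer_excess, inner_defect; rewrite !Cmod_RtoC_minus_pow2; field; auto.
Qed.

Lemma sum_over_Re_excess_defect (a : R) (ws : list C) :
  2 * a * sum_over Re ws =
  INR (length ws) * a ^ 2 - sum_over (outer_excess a) ws - sum_over inner_defect ws.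
Proof.
  rewrite <- sum_over_scal, (sum_over_ext _
    (fun w => a ^ 2 + (-1 * outer_excess a w + -1 * inner_defect w))).
  - rewrite !sum_over_plus, !sum_over_scal, sum_over_const; ring.
  - intros w; unfold outer_excess, inner_defect; rewrite Cmod_RtoC_minus_pow2; ring.
Qed.

Lemma lune_Cmod_minus_le (a s : R) (w : C) :
  0 < a < 1 -> 0 <= s <= a -> in_lune a w ->
  Cmod (s - w) <= Cmod (a - w) * exp (- (s * (a - s)) / 2).
Proof.
  intros Ha Hs Hw.
  pose proof (outer_excess_ge_0 a w Hw) as Hout.
  pose proof (inner_defect_ge_0 a w Hw) as Hin.
  apply Rsqr_incr_0_var; [|apply Rmult_le_pos; [apply Cmod_ge_0 | left; apply exp_pos]].
  rewrite !Rsqr_pow2, Rpow_mult_distr, exp_half_pow2.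
  apply Rle_trans with (Cmod (a - w) ^ 2 * (1 - s * (a - s))).
  - rewrite (Cmod_minus_pow2_interp a) by lra.
    replace (Cmod (a - w) ^ 2) with (1 + outer_excess a w) by (unfold outer_excess; ring).
    assert (Ht : 0 <= 1 - s / a).
    { replace (1 - s / a) with ((a - s) / a) by (field; lra); apply Rdiv_le_0_compat; lra. }
    replace (s * (a - s)) with (a * s * (1 - s / a)) by (field; lra).
    set (t := 1 - s / a) in *; replace (s / a) with (1 - t) by (unfold t; ring).
    assert (0 <= t * (outer_excess a w * (1 - a * s))) by (repeat apply Rmult_le_pos; nra).
    pose proof (Rmult_le_pos _ _ Ht Hin); lra.
  - apply Rmult_le_compat_l; [apply pow2_ge_0|].
    pose proof (exp_ineq1_le (- (s * (a - s)))); lra.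
Qed.

Lemma root_prod_unit_disk_pow2_le (rs : list C) (s : R) :
  (forall r, In r rs -> Cmod r <= 1) ->
  Cmod (root_prod rs s) ^ 2 <= exp (INR (length rs) * s ^ 2 - 2 * s * sum_over Re rs).
Proof.
  intros Hr.
  replace (INR (length rs) * s ^ 2 - 2 * s * sum_over Re rs) with
    (sum_over (fun r => s ^ 2 + -2 * s * Re r) rs)
    by (rewrite sum_over_plus, sum_over_const, sum_over_scal; ring).
  apply root_prod_pow2_le_exp; intros r Hin.
  eapply Rle_trans; [|apply exp_ineq1_le].
  pose proof (Hr r Hin); pose proof (Cmod_ge_0 r); rewrite Cmod_RtoC_minus_pow2; nra.
Qed.

(** * Polynomials contradicting Sendov's conjecture *)

Section SendovCounterexample.

Variables (a : R) (rs ws : list C).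

Local Notation n := (INR (length rs)).
Local Notation m := (INR (length ws)).
Local Notation P := (root_prod rs).
Local Notation Q := (root_prod ws).
Local Notation L := (log_deriv ws a).
Local Notation M := (Cmod (Q a)).
Local Notation Pmid := (Cmod (P (a / 2)%R)).
Local Notation total_excess := (sum_over (outer_excess a) ws).
Local Notation total_defect := (sum_over inner_defect ws).

Hypothesis a_bounds : 0 < a < 1.
Hypothesis length_rs : length rs = S (length ws).
Hypothesis P_root : P a = 0%C.
Hypothesis P_at_0 : Cmod (P 0) <= a.
Hypothesis rs_in_disk : forall r, In r rs -> Cmod r <= 1.
Hypothesis ws_in_lune : forall w, In w ws -> in_lune a w.
Hypothesis P_deriv : forall z : C, is_derive P z (n * Q z)%C.
Hypothesis same_centroid : m * sum_over Re rs = n * sum_over Re ws.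
Hypothesis degree_large : 144 * (1 + a) <= m * a ^ 2.
Hypothesis exp_degree_small : exp (- (m * a ^ 2 / 64)) <= a / 6.

Lemma deriv_degree_ge : 144 <= m.
Proof. pose proof (pos_INR (length ws)); nra. Qed.

Lemma degree_eq : n = m + 1.
Proof. rewrite length_rs; apply S_INR. Qed.

Lemma Q_at_a_ge_1 : 1 <= M.
Proof. apply root_prod_ge_1; intros w Hw; now apply ws_in_lune. Qed.

Lemma Q_le_mul_exp (s : R) :
  0 <= s <= a -> Cmod (Q s) <= M * exp (- (m * (s * (a - s)) / 2)).
Proof.
  intros Hs.
  replace (- (m * (s * (a - s)) / 2)) with (m * (- (s * (a - s)) / 2)) by field.
  rewrite exp_INR_mult; apply root_prod_le_root_prod; intros w Hw.
  now apply lune_Cmod_minus_le, ws_in_lune.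
Qed.

Lemma Q_le_exp_excess_defect (s : R) :
  Cmod (Q s) <= exp ((s / a * total_excess - (1 - s / a) * total_defect - m * (s * (a - s))) / 2).
Proof.
  apply le_exp_half.
  replace (s / a * total_excess - (1 - s / a) * total_defect - m * (s * (a - s))) with
    (sum_over (fun w => s / a * outer_excess a w + - (1 - s / a) * inner_defect w
      + - (s * (a - s))) ws)
    by (rewrite !sum_over_plus, !sum_over_scal, sum_over_const; ring).
  apply root_prod_pow2_le_exp; intros w _.
  rewrite (Cmod_minus_pow2_interp a) by lra; apply exp_ineq1_le.
Qed.

Lemma total_excess_le_ln : total_excess <= 6 * ln M.
Proof.
  apply sum_pow2_sub_1_le_ln; intros w Hw; destruct (ws_in_lune w Hw); split; auto.
  replace (a - w)%C with (a + - w)%C by ring.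
  eapply Rle_trans; [apply Cmod_triangle|].
  rewrite Cmod_opp, Cmod_R, Rabs_pos_eq; lra.
Qed.

Lemma total_defect_ge_0 : 0 <= total_defect.
Proof. apply sum_over_ge_0; intros w Hw; now apply (inner_defect_ge_0 a), ws_in_lune. Qed.

Lemma P_increment_le (phi dphi : R -> R) (u v : R) :
  u <= v ->
  (forall s, u <= s <= v -> is_derive phi s (dphi s)) ->
  (forall s, u <= s <= v -> n * Cmod (Q s) <= dphi s) ->
  Cmod (P v - P u) <= phi v - phi u.
Proof.
  intros Huv Hphi Hle.
  apply (Cmod_increment_le P (fun z => n * Q z)%C phi dphi); auto.
  intros s Hs; rewrite Cmod_INR_mult; auto.
Qed.

Lemma P_le_of_Q_le_exp (b k d c : R) :
  0 <= b -> 0 < k -> 0 <= c ->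
  (forall s, 0 <= s <= c -> Cmod (Q s) <= b * exp (- (k * s)) + d) ->
  Cmod (P c) <= a + n * (b / k + d * c).
Proof.
  intros Hb Hk Hc Hle; pose proof (pos_INR (length rs)) as Hn.
  pose proof (P_increment_le (fun s => n * (- (b / k) * exp (- (k * s)) + d * s))
    (fun s => n * (b * exp (- (k * s)) + d)) 0 c Hc) as Hinc; cbv beta in Hinc.
  pose proof (Cmod_triangle (P 0) (P c - P 0)) as Htri.
  replace (P 0 + (P c - P 0))%C with (P c) in Htri by ring.
  eapply Rle_trans; [exact Htri|]; apply Rplus_le_compat; [auto|].
  eapply Rle_trans; [apply Hinc|].
  - intros s _; auto_derive; [auto|]; field; lra.
  - intros s Hs; apply Rmult_le_compat_l; auto.
  - rewrite <- Rmult_minus_distr_l, !Rmult_0_r, Ropp_0, exp_0.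
    apply Rmult_le_compat_l; [auto|].
    assert (0 <= b / k * exp (- (k * c))); [|lra].
    apply Rmult_le_pos; [now apply Rdiv_le_0_compat | apply Rlt_le, exp_pos].
Qed.

Local Notation rate := (m * a / 4).
Local Notation decay s := (exp (- (rate * (a - s)))).
Local Notation err := (32 / (m * a ^ 2)).

Lemma Q_le_mul_decay (s : R) : a / 2 <= s <= a -> Cmod (Q s) <= M * decay s.
Proof.
  intros Hs; eapply Rle_trans; [apply Q_le_mul_exp; lra|].
  apply Rmult_le_compat_l; [apply Cmod_ge_0|]; apply exp_le_compat.
  pose proof (pos_INR (length ws)).
  assert (0 <= m * (a - s) * (s - a / 2)) by (repeat apply Rmult_le_pos; lra); lra.
Qed.

Lemma err_mul_le : err * (1 + a) <= 2 / 9.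
Proof.
  apply Rmult_le_reg_r with (m * a ^ 2); [lra|].
  replace (err * (1 + a) * (m * a ^ 2)) with (32 * (1 + a)); [lra|].
  field; pose proof deriv_degree_ge; lra.
Qed.

Lemma err_bounds : 0 < err <= 2 / 9.
Proof.
  assert (0 < err) by (apply Rdiv_lt_0_compat; lra); pose proof err_mul_le; split; nra.
Qed.

Lemma rate_mul_P_le (c : R) :
  a / 2 <= c <= a -> rate * Cmod (P c) <= n * M * (1 - decay c).
Proof.
  intros Hc.
  pose proof deriv_degree_ge as Hm; pose proof (pos_INR (length rs)) as Hn.
  assert (Hrate : 0 < rate) by (apply Rdiv_lt_0_compat; [apply Rmult_lt_0_compat|]; lra).
  pose proof (P_increment_le (fun s => n * M / rate * decay s) (fun s => n * M * decay s)
    c a ltac:(lra)) as Hinc; cbv beta in Hinc.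
  rewrite P_root, Cmod_minus_sym, Cminus_0_r in Hinc.
  replace (n * M * (1 - decay c)) with (rate * (n * M / rate * decay a - n * M / rate * decay c)).
  - apply Rmult_le_compat_l; [lra|]; apply Hinc; intros s Hs.
    + auto_derive; [auto|]; unfold Rminus; field; lra.
    + rewrite Rmult_assoc; apply Rmult_le_compat_l; [auto|]; apply Q_le_mul_decay; lra.
  - replace (- (rate * (a - a))) with 0 by ring; rewrite exp_0; field; lra.
Qed.

Lemma log_deriv_minus_at_a_le (s : R) :
  a / 2 <= s <= a -> Cmod (L - log_deriv ws s) <= 2 * m * (a - s).
Proof.
  intros Hs.
  assert (Hdist : Cmod (a - s) = a - s).
  { rewrite <- RtoC_minus, Cmod_R, Rabs_pos_eq; lra. }
  replace (2 * m * (a - s)) with (m * (Cmod (s - a) * (/ 1 * / (1 / 2))))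
    by (rewrite Cmod_minus_sym, Hdist; field).
  apply log_deriv_minus_le; [lra..|]; intros w Hw.
  destruct (ws_in_lune w Hw) as [_ Ha]; split; auto.
  pose proof (Cmod_minus_triangle a s w); lra.
Qed.

Lemma is_derive_log_deriv_mul_P_minus (s : R) :
  a / 2 <= s <= a ->
  is_derive (fun z => L * P z - n * Q z)%C (s : C) (n * Q s * (L - log_deriv ws s))%C.
Proof.
  intros Hs; evar_last.
  - apply (is_derive_minus (V := C_NormedModule) (fun z => L * P z)%C (fun z => n * Q z)%C).
    + apply is_derive_Cmult_const, P_deriv.
    + apply is_derive_Cmult_const, is_derive_root_prod; intros w Hw <-.
      destruct (ws_in_lune _ Hw) as [_ Hdist].
      rewrite <- RtoC_minus, Cmod_R, Rabs_pos_eq in Hdist; lra.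
  - unfold minus, plus, opp; simpl; ring.
Qed.

(* Since [P'' / P' = log_deriv ws] hardly varies near [a], neither does
   [L * P - P'].  The term in [decay c] is kept because for [c = a / 2] it
   outweighs [n * Q c]. *)
Lemma log_deriv_mul_P_approx (c : R) :
  a / 2 <= c <= a ->
  Cmod (L * P c - n * Q c + n * Q a) <=
  n * M * (err * (1 - (1 + rate * (a - c)) * decay c)).
Proof.
  intros Hc; pose proof deriv_degree_ge as Hm; pose proof (pos_INR (length rs)) as Hn.
  assert (Hma : 0 < m * a) by (apply Rmult_lt_0_compat; lra).
  set (phi := fun s => 2 * n * M * m * ((a - s) / rate + / rate ^ 2) * decay s).
  set (dphi := fun s => n * (M * decay s) * (2 * m * (a - s))).
  pose proof (Cmod_increment_le (fun z => L * P z - n * Q z)%C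
    (fun z => n * Q z * (L - log_deriv ws z))%C phi dphi c a ltac:(lra)) as Hinc.
  cbv beta in Hinc; rewrite Cmod_minus_sym, P_root in Hinc.
  replace (L * P c - n * Q c - (L * 0 - n * Q a))%C
    with (L * P c - n * Q c + n * Q a)%C in Hinc by ring.
  eapply Rle_trans; [apply Hinc|].
  - intros s Hs; apply is_derive_log_deriv_mul_P_minus; lra.
  - intros s _; unfold phi, dphi; auto_derive; [auto|]; unfold Rminus; field; lra.
  - intros s Hs; rewrite Cmod_mult, Cmod_INR_mult; unfold dphi.
    apply Rmult_le_compat; auto using Cmod_ge_0, Rmult_le_pos.
    + apply Rmult_le_compat_l; [auto|]; apply Q_le_mul_decay; lra.
    + apply log_deriv_minus_at_a_le; lra.
  - right; unfold phi.
    replace (- (rate * (a - a))) with 0 by ring; rewrite exp_0; field; lra.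
Qed.

Lemma log_deriv_mul_P_le (c : R) :
  a / 2 <= c <= a -> Cmod L * Cmod (P c) <= n * M * (1 + err + decay c).
Proof.
  intros Hc; rewrite <- Cmod_mult.
  pose proof (Cmod_triangle3 (L * P c - n * Q c + n * Q a) (n * Q c) (- (n * Q a))) as Htri.
  replace (L * P c - n * Q c + n * Q a + n * Q c + - (n * Q a))%C with (L * P c)%C in Htri by ring.
  rewrite Cmod_opp, !Cmod_INR_mult in Htri.
  pose proof (log_deriv_mul_P_approx c Hc) as Happrox.
  pose proof deriv_degree_ge; pose proof err_bounds; pose proof (pos_INR (length rs)) as Hn.
  assert (n * Cmod (Q c) <= n * (M * decay c)) by now apply Rmult_le_compat_l, Q_le_mul_decay.
  assert (0 <= n * M * (err * ((1 + rate * (a - c)) * decay c))).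
  { repeat apply Rmult_le_pos; try lra; auto using Cmod_ge_0, Rlt_le, exp_pos.
    apply Rplus_le_le_0_compat; [lra|]; repeat apply Rmult_le_pos; lra. }
  lra.
Qed.

Lemma log_deriv_mul_P_mid_ge : (1 - err) * (n * M) <= Cmod L * Pmid.
Proof.
  set (h := (a / 2)%R); assert (Hh : a / 2 <= h <= a) by (unfold h; lra).
  rewrite <- Cmod_mult.
  pose proof (Cmod_triangle3 (L * P h - n * Q h + n * Q a) (- (L * P h)) (n * Q h)) as Htri.
  replace (L * P h - n * Q h + n * Q a + - (L * P h) + n * Q h)%C with (n * Q a)%C in Htri by ring.
  rewrite Cmod_opp, !Cmod_INR_mult in Htri.
  pose proof (log_deriv_mul_P_approx h Hh) as Happrox.
  pose proof deriv_degree_ge; pose proof err_bounds; pose proof (pos_INR (length rs)) as Hn.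
  assert (n * Cmod (Q h) <= n * (M * decay h)) by now apply Rmult_le_compat_l, Q_le_mul_decay.
  assert (Herr : err * (1 + rate * (a - h)) = err + 4) by (unfold h; field; lra).
  assert (0 <= n * M * ((err + 3) * decay h)).
  { repeat apply Rmult_le_pos; try lra; auto using Cmod_ge_0, Rlt_le, exp_pos. }
  replace (err * (1 - (1 + rate * (a - h)) * decay h)) with
    (err - err * (1 + rate * (a - h)) * decay h) in Happrox by ring.
  rewrite Herr in Happrox; lra.
Qed.

Lemma log_deriv_at_a_le : Cmod L <= m.
Proof.
  replace m with (m * / 1) by field.
  apply log_deriv_le; [lra|]; intros w Hw; now apply ws_in_lune.
Qed.

Lemma P_mid_ge : 7 / 9 * M <= Pmid.
Proof.
  pose proof log_deriv_mul_P_mid_ge as Hge; pose proof log_deriv_at_a_le as HL.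
  pose proof deriv_degree_ge as Hm; pose proof Q_at_a_ge_1 as HM; pose proof err_bounds as Herr.
  rewrite degree_eq in Hge; pose proof (Cmod_ge_0 (P (a / 2)%R)) as HP.
  apply Rmult_le_reg_l with m; [lra|].
  assert (7 / 9 * (m * M) <= (1 - err) * ((m + 1) * M)) by (apply Rmult_le_compat; nra).
  assert (Cmod L * Pmid <= m * Pmid) by now apply Rmult_le_compat_r.
  lra.
Qed.

Local Notation E := (exp (- (m * a ^ 2 / 64))).

Lemma degree_mul_E_le : m * a ^ 2 * E <= 64.
Proof. pose proof (mul_exp_opp_le_1 (m * a ^ 2 / 64)); lra. Qed.

(* As [total_excess <= 6 * ln M], the excess contributes at most [sqrt M] to
   [Q_le_exp_excess_defect] as long as [s / a <= 1 / 6]. *)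
Lemma Q_le_sqrt_mul_exp (s : R) :
  0 <= s <= a / 2 ->
  Cmod (Q s) <= sqrt M * exp (- (5 * (m * a) / 12 * s)) + M * E ^ 4.
Proof.
  intros Hs; pose proof Q_at_a_ge_1 as HM; pose proof (pos_INR (length ws)) as Hm.
  destruct (Rle_dec s (a / 6)) as [Hs6|Hs6].
  - assert (Hx : 0 <= M * E ^ 4) by (apply Rmult_le_pos; [lra | apply pow_le, Rlt_le, exp_pos]).
    enough (Cmod (Q s) <= sqrt M * exp (- (5 * (m * a) / 12 * s))) by lra.
    eapply Rle_trans; [apply Q_le_exp_excess_defect|].
    rewrite <- exp_half_ln, <- exp_plus by lra; apply exp_le_compat.
    assert (Hsa : 0 <= s / a <= 1 / 6).
    { split; [apply Rdiv_le_0_compat; lra|]; apply Rle_div_l; lra. }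
    pose proof total_defect_ge_0; pose proof total_excess_le_ln.
    assert (0 <= ln M) by (rewrite <- ln_1; apply ln_le; lra).
    assert (s / a * total_excess <= ln M) by nra.
    assert (0 <= (1 - s / a) * total_defect) by (apply Rmult_le_pos; lra).
    assert (0 <= m * s * (a / 6 - s)) by (repeat apply Rmult_le_pos; lra).
    lra.
  - assert (Hx : 0 <= sqrt M * exp (- (5 * (m * a) / 12 * s))).
    { apply Rmult_le_pos; [apply sqrt_pos | apply Rlt_le, exp_pos]. }
    enough (Cmod (Q s) <= M * E ^ 4) by lra.
    eapply Rle_trans; [apply Q_le_mul_exp; lra|].
    apply Rmult_le_compat_l; [lra|].
    rewrite <- exp_INR_mult; apply exp_le_compat; simpl.
    assert (a ^ 2 / 8 <= s * (a - s)) by nra.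
    assert (m * (a ^ 2 / 8) <= m * (s * (a - s))) by now apply Rmult_le_compat_l.
    lra.
Qed.

Lemma a_mul_P_mid_le :
  a * Pmid <= a ^ 2 + n / m * (12 / 5 * sqrt M + M * (m * a ^ 2 * E ^ 4) / 2).
Proof.
  pose proof deriv_degree_ge as Hm; assert (Hma : 0 < m * a) by (apply Rmult_lt_0_compat; lra).
  pose proof (P_le_of_Q_le_exp (sqrt M) (5 * (m * a) / 12) (M * E ^ 4) (a / 2)
    (sqrt_pos M) ltac:(lra) ltac:(lra) Q_le_sqrt_mul_exp) as Hle.
  apply (Rmult_le_compat_l a) in Hle; [|lra].
  eapply Rle_trans; [exact Hle|]; right; field; lra.
Qed.

Lemma degree_ratio_bounds : 1 <= n / m <= 145 / 144.
Proof.
  pose proof deriv_degree_ge; rewrite degree_eq.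
  split; [apply Rle_div_r; lra | apply Rle_div_l; lra].
Qed.

Lemma sqrt_Q_at_a_mul_a_le : sqrt M * a <= 6.
Proof.
  pose proof a_mul_P_mid_le as Hle; pose proof P_mid_ge as Hge; pose proof Q_at_a_ge_1 as HM.
  pose proof degree_ratio_bounds; pose proof degree_mul_E_le as HxE.
  set (r := sqrt M) in *.
  assert (Hr : M = r * r) by (symmetry; apply sqrt_sqrt; lra).
  assert (Hr1 : 1 <= r) by (unfold r; rewrite <- sqrt_1; apply sqrt_le_1; lra).
  assert (HE : 0 < E) by apply exp_pos.
  assert (HE3 : E ^ 3 <= a / 216).
  { apply Rle_trans with ((a / 6) ^ 3); [apply pow_incr; lra|]; nra. }
  assert (HxE4 : m * a ^ 2 * E ^ 4 <= 64 * (a / 216)).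
  { replace (m * a ^ 2 * E ^ 4) with (m * a ^ 2 * E * E ^ 3) by ring.
    apply Rmult_le_compat; auto using pow_le, Rlt_le.
    apply Rmult_le_pos; lra. }
  assert (HMx : M * (m * a ^ 2 * E ^ 4) <= M * (64 * (a / 216))) by (apply Rmult_le_compat_l; lra).
  assert (Hsum : n / m * (12 / 5 * r + M * (m * a ^ 2 * E ^ 4) / 2) <=
    145 / 144 * (12 / 5 * r + M * (64 * (a / 216)) / 2)).
  { apply Rle_trans with (n / m * (12 / 5 * r + M * (64 * (a / 216)) / 2)).
    - apply Rmult_le_compat_l; lra.
    - apply Rmult_le_compat_r; [nra | lra]. }
  apply (Rmult_le_compat_l a) in Hge; [|lra].
  assert (a ^ 2 <= 1) by nra.
  assert (0 <= M * a) by (apply Rmult_le_pos; lra).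
  assert (Hquad : 31 / 50 * (M * a) <= r * (41 / 12)) by lra.
  rewrite Hr in Hquad; apply Rmult_le_reg_l with r; lra.
Qed.

Lemma total_excess_le : total_excess <= 3 / 16 * (m * a ^ 2).
Proof.
  eapply Rle_trans; [apply total_excess_le_ln|].
  enough (ln M <= m * a ^ 2 / 32) by lra.
  pose proof Q_at_a_ge_1 as HM; pose proof sqrt_Q_at_a_mul_a_le as Hr.
  assert (Hle : sqrt M <= exp (m * a ^ 2 / 64)).
  { pose proof (exp_mul_exp_opp (m * a ^ 2 / 64)).
    pose proof (exp_pos (m * a ^ 2 / 64)); pose proof (sqrt_pos M).
    assert (sqrt M * E <= 1) by nra; nra. }
  apply ln_le in Hle; [|apply sqrt_lt_R0; lra].
  rewrite ln_exp, <- exp_half_ln, ln_exp in Hle by lra; lra.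
Qed.

(* Otherwise the roots, having the same centroid as the critical points, would
   have mean real part at least [9 * a / 32], which makes [P (a / 2)] too small. *)
Lemma total_defect_ge : m * a ^ 2 / 4 <= total_defect.
Proof.
  apply Rnot_lt_le; intros Hdef.
  pose proof P_mid_ge as Hge; pose proof Q_at_a_ge_1 as HM; pose proof total_excess_le as Hexc.
  pose proof deriv_degree_ge as Hm; pose proof (sum_over_Re_excess_defect a ws) as Hws.
  pose proof (root_prod_unit_disk_pow2_le rs (a / 2)%R rs_in_disk) as Hsmall.
  assert (Hre : n * (9 * a / 32) <= sum_over Re rs).
  { apply Rmult_le_reg_l with (2 * a * m); [apply Rmult_lt_0_compat; lra|].
    replace (2 * a * m * sum_over Re rs) with (n * (2 * a * sum_over Re ws))
      by (replace (2 * a * m * sum_over Re rs) with (2 * a * (m * sum_over Re rs)) by ring;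
          rewrite same_centroid; ring).
    rewrite Hws.
    replace (2 * a * m * (n * (9 * a / 32))) with (n * (9 / 16 * (m * a ^ 2))) by field.
    apply Rmult_le_compat_l; [apply pos_INR | lra]. }
  assert (Hexp : exp (n * (a / 2) ^ 2 - 2 * (a / 2) * sum_over Re rs) <= E ^ 2).
  { rewrite <- exp_INR_mult; apply exp_le_compat; simpl.
    pose proof degree_eq; nra. }
  assert (E ^ 2 <= 1 / 36) by (pose proof (exp_pos (- (m * a ^ 2 / 64))); nra).
  assert (Pmid ^ 2 <= 1 / 36) by lra.
  nra.
Qed.

Lemma Q_left_half_le (s : R) : 0 <= s <= a / 2 -> Cmod (Q s) <= E ^ 8.
Proof.
  intros Hs; eapply Rle_trans; [apply Q_le_exp_excess_defect|].
  rewrite <- exp_INR_mult; apply exp_le_compat.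
  pose proof total_excess_le as Hexc; pose proof total_defect_ge as Hdef.
  assert (Hsa : 0 <= s / a <= 1 / 2).
  { split; [apply Rdiv_le_0_compat; lra | apply Rle_div_l; lra]. }
  replace (m * (s * (a - s))) with (m * a ^ 2 * (s / a * (1 - s / a))) by (field; lra).
  replace (INR 8) with 8 by (simpl; lra).
  set (t := s / a) in *; set (x := m * a ^ 2) in *.
  assert (t * total_excess <= t * (3 / 16 * x)) by (apply Rmult_le_compat_l; lra).
  assert ((1 - t) * (x / 4) <= (1 - t) * total_defect) by (apply Rmult_le_compat_l; lra).
  assert (0 <= x * (t * (1 / 2 - t))) by
    (apply Rmult_le_pos; [|apply Rmult_le_pos]; lra).
  assert (0 <= x * t) by (apply Rmult_le_pos; lra).
  lra.
Qed.

Lemma P_left_half_le (c : R) : 0 <= c <= a / 2 -> Cmod (P c) <= a + 1 / 1000.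
Proof.
  intros Hc; pose proof (pos_INR (length rs)) as Hn; pose proof deriv_degree_ge as Hm.
  eapply Rle_trans.
  { apply (P_le_of_Q_le_exp 0 1 (E ^ 8) c); [lra..|].
    intros s Hs; rewrite Rmult_0_l, Rplus_0_l; apply Q_left_half_le; lra. }
  apply Rplus_le_compat_l.
  assert (HE : 0 < E) by apply exp_pos.
  assert (HE7 : E ^ 7 <= a / 6 * (1 / 6) ^ 6).
  { change (E ^ 7) with (E * E ^ 6).
    apply Rmult_le_compat; auto using pow_le, Rlt_le; apply pow_incr; lra. }
  apply Rle_trans with (n / m * (m * a ^ 2 * E) * E ^ 7 / (2 * a)).
  - replace (n / m * (m * a ^ 2 * E) * E ^ 7 / (2 * a)) with (n * (0 / 1 + E ^ 8 * (a / 2)))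
      by (field; lra).
    repeat apply Rmult_le_compat_l; auto; apply Rplus_le_compat_l.
    apply Rmult_le_compat_l; [|lra]; auto using pow_le, Rlt_le.
  - apply Rle_div_l; [lra|].
    apply Rle_trans with (145 / 144 * 64 * (a / 6 * (1 / 6) ^ 6)); [|lra].
    pose proof degree_ratio_bounds; pose proof degree_mul_E_le.
    assert (0 <= m * a ^ 2 * E) by (apply Rmult_le_pos; lra).
    repeat (apply Rmult_le_compat; try lra).
    + apply Rmult_le_pos; lra.
    + auto using pow_le, Rlt_le.
Qed.

Lemma P_le_near_a (c : R) :
  a / 2 <= c <= a -> (1 - err) * (a / 4 * Cmod (P c)) <= Pmid * (1 - decay c).
Proof.
  intros Hc; pose proof (rate_mul_P_le c Hc); pose proof log_deriv_mul_P_mid_ge.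
  pose proof log_deriv_at_a_le; pose proof deriv_degree_ge; pose proof err_bounds as Herr.
  assert (Hdecay : decay c <= 1).
  { rewrite <- exp_0; apply exp_le_compat.
    assert (0 <= rate * (a - c)) by (repeat apply Rmult_le_pos; lra); lra. }
  assert (Cmod L * Pmid <= m * Pmid) by (apply Rmult_le_compat_r; auto using Cmod_ge_0).
  apply Rmult_le_reg_l with m; [lra|].
  apply Rle_trans with ((1 - err) * (n * M) * (1 - decay c)).
  - assert ((1 - err) * (rate * Cmod (P c)) <= (1 - err) * (n * M * (1 - decay c)))
      by (apply Rmult_le_compat_l; lra).
    lra.
  - rewrite <- (Rmult_assoc m); apply Rmult_le_compat_r; lra.
Qed.

Lemma P_le_far_from_a (c : R) :
  a / 2 <= c <= a -> (1 - err) * Cmod (P c) <= Pmid * (1 + err + decay c).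
Proof.
  intros Hc; pose proof (log_deriv_mul_P_le c Hc) as Hle; pose proof log_deriv_mul_P_mid_ge as Hge.
  pose proof err_bounds as Herr; pose proof (exp_pos (- (rate * (a - c)))).
  pose proof deriv_degree_ge; pose proof Q_at_a_ge_1.
  assert (HL : 0 < Cmod L).
  { destruct (Cmod_ge_0 L) as [HL|HL]; auto; rewrite <- HL, Rmult_0_l in Hge.
    assert (0 < (1 - err) * (n * M))
      by (repeat apply Rmult_lt_0_compat; try rewrite degree_eq; lra).
    lra. }
  apply Rmult_le_reg_l with (Cmod L); [auto|].
  apply Rle_trans with ((1 - err) * (n * M) * (1 + err + decay c)).
  - assert ((1 - err) * (Cmod L * Cmod (P c)) <= (1 - err) * (n * M * (1 + err + decay c)))
      by (apply Rmult_le_compat_l; lra).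
    lra.
  - rewrite <- (Rmult_assoc (Cmod L)); apply Rmult_le_compat_r; lra.
Qed.

(* The sum of the two previous bounds is free of [decay c]. *)
Lemma P_right_half_le (c : R) : a / 2 <= c <= a -> Cmod (P c) <= 1 + a.
Proof.
  intros Hc.
  pose proof (P_le_near_a c Hc) as Hnear; pose proof (P_le_far_from_a c Hc) as Hfar.
  pose proof (P_left_half_le (a / 2) ltac:(lra)) as Hmid.
  pose proof err_bounds as He; pose proof err_mul_le as Hmul.
  set (e := err) in *; set (y := Cmod (P c)) in *.
  assert (Hsum : (1 - e) * (1 + a / 4) * y <= (a + 1 / 1000) * (2 + e)).
  { apply Rle_trans with (Pmid * (2 + e)); [lra | apply Rmult_le_compat_r; lra]. }
  assert (Hae : a * e <= 1 / 9) by nra.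
  apply Rmult_le_reg_l with ((1 - e) * (1 + a / 4)); [apply Rmult_lt_0_compat; lra|].
  eapply Rle_trans; [exact Hsum|].
  assert ((7 / 9 + a) * (1 + a / 4) <= (1 - e) * (1 + a) * (1 + a / 4))
    by (apply Rmult_le_compat_r; lra).
  nra.
Qed.

Theorem root_prod_le_1_plus_a (c : R) : 0 <= c <= a -> Cmod (P c) <= 1 + a.
Proof.
  intros Hc; destruct (Rle_dec c (a / 2)).
  - pose proof (P_left_half_le c ltac:(lra)); lra.
  - apply P_right_half_le; lra.
Qed.

End SendovCounterexample.

Lemma is_derive_root_prod_pderiv (rs : list C) (z : C) :
  is_derive (root_prod rs) z (peval (pderiv (prod_Xsub rs)) z : C).
Proof.
  apply (is_derive_ext (peval (prod_Xsub rs) : C -> C)).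
  - intros w; apply CriticalPoints.peval_prod_Xsub.
  - apply is_derive_peval.
Qed.

Lemma Cnorm_Cmod (z : C) : Cnorm z = Cmod z.
Proof. unfold Cnorm, Cmod; f_equal; ring. Qed.

Lemma root_prod_at_0_le (a : R) (zs : list C) :
  0 < a -> (forall z, In z zs -> Cmod z <= 1) -> Cmod (root_prod ((a : C) :: zs) 0) <= a.
Proof.
  intros Ha Hz; cbn [root_prod].
  rewrite Cmod_mult, Cmod_minus_sym, Cminus_0_r, Cmod_R, Rabs_pos_eq by lra.
  apply Rle_trans with (a * 1); [|lra].
  apply Rmult_le_compat_l; [lra|]; apply root_prod_le_1; intros z Hin.
  rewrite Cmod_minus_sym, Cminus_0_r; auto.
Qed.

Lemma critical_point_in_lune (a : R) (zs : list C) (w : C) :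
  (forall r, In r ((a : C) :: zs) -> Cmod r <= 1) -> contradicts_sendov a zs ->
  peval (pderiv (sendov_poly a zs)) w = C0 -> in_lune a w.
Proof.
  intros Hr Hs Hw; split.
  - rewrite <- (Cminus_0_r w); apply (Gauss_Lucas_disk ((a : C) :: zs)); [discriminate| |].
    + intros r Hin; rewrite Cminus_0_r; auto.
    + change (0 : C) with C0; rewrite <- Hw; apply is_derive_root_prod_pderiv.
  - rewrite Cmod_minus_sym, <- Cnorm_Cmod; left; exact (Hs w Hw).
Qed.

Lemma degree_large_of_N1 (m : nat) (a : R) :
  0 < a < 1 -> N1 a <= INR (S m) -> 144 * (1 + a) <= INR m * a ^ 2.
Proof.
  intros Ha HN.
  assert (H : 9 * ((4 + 2 * a) / a) ^ 2 <= INR (S m)) by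
    (eapply Rle_trans; [apply Rmax_l | exact HN]).
  apply (Rmult_le_compat_r (a ^ 2)) in H; [|apply pow2_ge_0].
  replace (9 * ((4 + 2 * a) / a) ^ 2 * a ^ 2) with (9 * (4 + 2 * a) ^ 2) in H by (field; lra).
  rewrite S_INR in H; nra.
Qed.

Lemma exp_degree_small_of_N1 (m : nat) (a : R) :
  0 < a < 1 -> N1 a <= INR (S m) -> exp (- (INR m * a ^ 2 / 64)) <= a / 6.
Proof.
  intros Ha HN.
  assert (H : 32 * ln (40 / a ^ 2) / a ^ 2 <= INR (S m)) by
    (eapply Rle_trans; [apply Rmax_r | exact HN]).
  assert (Ha2 : 0 < a ^ 2 <= 1) by nra.
  apply (Rmult_le_compat_r (a ^ 2)) in H; [|lra].
  replace (32 * ln (40 / a ^ 2) / a ^ 2 * a ^ 2) with (32 * ln (40 / a ^ 2)) in H by (field; lra).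
  rewrite S_INR in H.
  assert (Hexp : exp (- (INR m * a ^ 2 / 32)) <= a ^ 2 / 40 * exp (1 / 32)).
  { replace (a ^ 2 / 40) with (/ (40 / a ^ 2)) by (field; lra).
    rewrite <- (exp_ln (40 / a ^ 2)), <- exp_Ropp, <- exp_plus by (apply Rdiv_lt_0_compat; lra).
    apply exp_le_compat; lra. }
  assert (H32 : exp (1 / 32) <= 1 + 3 * (1 / 32)) by (apply exp_le_affine; lra).
  apply Rsqr_incr_0_var; [|lra].
  rewrite !Rsqr_pow2, <- exp_INR_mult.
  replace (INR 2 * - (INR m * a ^ 2 / 64)) with (- (INR m * a ^ 2 / 32)) by (simpl; field).
  nra.
Qed.

Theorem mainTheorem5 (n : nat) (a c : R) (zs : list Cx) :
  0 < a < 1 ->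
  0 < c < a ->
  (1 <= n)%nat ->
  length zs = (n - 1)%nat ->
  (forall z, In z zs -> Cnorm z <= 1) ->
  contradicts_sendov a zs ->
  INR n >= Rmax (N1 a) (N2 a c) ->
  Cnorm (peval (sendov_poly a zs) (RtoC c)) <= 1 + a.
Proof.
  intros Ha Hc Hn Hlen Hz Hs HN.
  set (rs := (a : C) :: zs).
  destruct (CriticalPoints.pderiv_prod_Xsub rs) as [ws [Hws [Hder Hcen]]]; [discriminate|].
  assert (HN1 : N1 a <= INR (S (length ws))).
  { rewrite <- Hws; change (length rs) with (S (@length Cx zs)); rewrite Hlen.
    replace (S (n - 1)) with n by lia.
    eapply Rle_trans; [apply Rmax_l | apply Rge_le, HN]. }
  assert (Hz' : forall z, In z zs -> Cmod z <= 1) by (intros; rewrite <- Cnorm_Cmod; auto).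
  assert (Hrs : forall r, In r rs -> Cmod r <= 1).
  { intros r [<-|Hr]; [rewrite Cmod_R, Rabs_pos_eq|]; auto; lra. }
  rewrite Cnorm_Cmod; unfold sendov_poly; rewrite CriticalPoints.peval_prod_Xsub.
  apply (root_prod_le_1_plus_a a rs ws);
    auto using degree_large_of_N1, exp_degree_small_of_N1; try lra.
  - apply root_prod_root; now left.
  - now apply root_prod_at_0_le.
  - intros w Hw; apply (critical_point_in_lune a zs); auto.
    change (peval (pderiv (prod_Xsub rs)) w = C0).
    rewrite Hder, (root_prod_root ws w Hw); apply Cmult_0_r.
  - intros z; rewrite <- Hder; apply is_derive_root_prod_pderiv.
Qed.
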